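(* There exists a lattice $L$ of rank $43$ such that every basis $b_1, \dots, b_{43}$ of $L$ which contains a shortest vector of $L$ (that is, a nonzero vector of $L$ of minimum length) satisfies $$\max\left\{ \|b_1\|, \dots, \|b_{43}\| \right\} > \overline{\lambda_{43}}(L).$$
   Context: A lattice is a discrete subgroup $L$ of some $\mathbb{R}^m$; its rank $n$ is the dimension of $\mathrm{span}_{\mathbb{R}}(L)$. $\|\cdot\|$ is the Euclidean norm. A basis of $L$ is a linearly independent sequence $b_1, \dots, b_n \in L$ with $\mathrm{span}_{\mathbb{Z}}(b_1, \dots, b_n) = L$. A sequence $b_1, \dots, b_i \in L$ is called primitive if it can be completed to a basis $b_1, \dots, b_n$ of $L$. $\overline{\lambda_i}(L)$ denotes the smallest real number such that there exists a primitive sequence $b_1, \dots, b_i \in L$ all of whose vectors have length at most $\overline{\lambda_i}(L)$. Thus for $L$ of rank $n$, $\overline{\lambda_n}(L)$ is the minimum over all bases of $L$ of the maximum length of a basis vector. *)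

(* Defs.v *)
From mathcomp Require Import all_boot all_order all_algebra.
From mathcomp Require Import all_classical all_reals.
From mathcomp Require Import topology normedtype.

Set Implicit Arguments.
Unset Strict Implicit.
Unset Printing Implicit Defensive.

Import Order.TTheory GRing.Theory Num.Theory.
Import numFieldNormedType.Exports.

Local Open Scope classical_set_scope.
Local Open Scope ring_scope.

(* The library's norm on row vectors is the sup norm, so the Euclidean norm
   has to be introduced separately (both induce the topology of 'rV[R]_m). *)
Definition enorm (R : realType) (m : nat) (v : 'rV[R]_m) : R :=
  Num.sqrt (\sum_(i < m) v 0 i ^+ 2).

Definition is_lattice (R : realType) (m : nat) (L : set 'rV[R]_m) : Prop :=
  zmod_closed (mem L) /\ L `<=` isolated L.

Definition real_span (R : realType) (m : nat) (L : set 'rV[R]_m) :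
    set 'rV[R]_m :=
  [set v | exists s : seq 'rV[R]_m, {subset s <= L} /\ v \in <<s>>%VS].

Definition lattice_rank (R : realType) (m : nat) (L : set 'rV[R]_m)
    (n : nat) : Prop :=
  exists U : {vspace 'rV[R]_m}, [set` U] = real_span L /\ \dim U = n.

(* The length n of a basis is necessarily the rank of L. *)
Definition is_lattice_basis (R : realType) (m : nat) (L : set 'rV[R]_m)
    (n : nat) (b : n.-tuple 'rV[R]_m) : Prop :=
  [/\ {subset b <= L}, free b & [set v | inIntSpan b v] = L].

Definition is_primitive (R : realType) (m : nat) (L : set 'rV[R]_m)
    (i : nat) (s : i.-tuple 'rV[R]_m) : Prop :=
  exists (n : nat) (b : n.-tuple 'rV[R]_m), is_lattice_basis L b /\ prefix s b.

Definition primitive_bounds (R : realType) (m : nat) (L : set 'rV[R]_m)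
    (i : nat) : set R :=
  [set r | exists s : i.-tuple 'rV[R]_m,
     is_primitive L s /\ forall v, v \in s -> enorm v <= r].

(* l is the i-th primitive minimum of L; it is given as a relation so that
   l is an attained minimum, with no default value when there is none. *)
Definition is_primitive_minimum (R : realType) (m : nat) (L : set 'rV[R]_m)
    (i : nat) (l : R) : Prop :=
  primitive_bounds L i l /\ lbound (primitive_bounds L i) l.

Definition is_shortest (R : realType) (m : nat) (L : set 'rV[R]_m)
    (v : 'rV[R]_m) : Prop :=
  [/\ L v, v != 0 & forall w, L w -> w != 0 -> enorm v <= enorm w].

(* Main.v *)
(* Give Z^43 the norm |x - t w|^2 + (t / 2)^2, where w = (2,...,2,3,...,3) with
   28 twos and 15 threes and t w is the orthogonal projection of x on the line
   spanned by w.  The shortest vectors are then +-w, of length 1 / 2, whereas any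
   vector no longer than the standard basis vectors is k w or k w +- e_j.  Since
   no coordinate of w is a unit, each coordinate j must be hit by some
   k w +- e_j in a basis of such vectors, so that all its 43 members are of this
   form and none is a multiple of w. *)
Require Import Defs.
From mathcomp Require Import all_boot all_order all_algebra.
From mathcomp Require Import all_classical all_reals.
From mathcomp Require Import topology normedtype ring lra zify.

Set Implicit Arguments.
Unset Strict Implicit.
Unset Printing Implicit Defensive.

Import Order.TTheory GRing.Theory Num.Theory.
Import numFieldNormedType.Exports.
Local Open Scope ring_scope.

(** * Integer vectors close to the line spanned by w *)

Lemma intr2 (R : pzRingType) : 2%:~R = 2 :> R. Proof. by []. Qed.
Lemma intr3 (R : pzRingType) : 3%:~R = 3 :> R. Proof. by []. Qed.

Lemma intr_unit_sqr (R : pzRingType) (s : int) :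
  `|s| <= 1 -> s != 0 -> s%:~R ^+ 2 = 1 :> R.
Proof.
move=> s1 s0; have [->|->] : s = 1 \/ s = -1 by lia.
  by rewrite expr1n.
by rewrite rmorphN sqrrN expr1n.
Qed.

Definition weight (i : 'I_43) : int := if (i < 28)%N then 2 else 3.

Lemma weight_cases i : weight i = 2 \/ weight i = 3.
Proof. by rewrite /weight; case: ifP; [left|right]. Qed.

Lemma sum_weight2 (R : pzRingType) : \sum_i (weight i)%:~R ^+ 2 = 247%:R :> R.
Proof.
have -> : 247%:R = (247 : int)%:~R :> R by [].
under eq_bigr do rewrite -rmorphXn.
rewrite -rmorph_sum; congr (_ %:~R).
by rewrite !big_ord_recl big_ord0.
Qed.

Lemma weight_class_sum (R : pzRingType) (a b : R) :
  \sum_(i < 43) (if (i < 28)%N then a else b) = a *+ 28 + b *+ 15.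
Proof.
rewrite -(big_mkord xpredT (fun i => if (i < 28)%N then a else b)).
rewrite (@big_cat_nat _ _ _ 28) //=; congr (_ + _).
  rewrite (@eq_big_nat _ _ _ _ _ _ (fun=> a)) ?sumr_const_nat //.
  by move=> i /andP[_ ->].
rewrite (@eq_big_nat _ _ _ _ _ _ (fun=> b)) ?sumr_const_nat //.
by move=> i /andP[hi _]; rewrite ltnNge hi.
Qed.

Lemma int_dist_ge (R : realFieldType) (n : int) (u : R) :
  n != 0 -> `|u| <= 1 -> (1 - `|u|) ^+ 2 <= (n%:~R - u) ^+ 2.
Proof.
move=> n0 u1.
have n1 : 1 <= `|n%:~R| :> R by rewrite -intr_norm ler1z; lia.
rewrite -[leRHS]real_normK ?num_real // ler_sqr ?nnegrE ?subr_ge0 //.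
by apply: le_trans (lerB_dist _ _); rewrite lerD2r.
Qed.

(* Let a and b be the integers among the coordinates that are closest to 2 t
   and 3 t.  By Cauchy-Schwarz |3 a - 2 b| < 1, so (a, b) = (2 k, 3 k), and the
   coordinates of x - k w are then all 0 except possibly one. *)
Lemma near_weight_line (R : realFieldType) (x : 'rV[int]_43) (t : R) :
  \sum_i ((x 0 i)%:~R - t * (weight i)%:~R) ^+ 2 < 1 ->
  exists k s j, x = k *: \row_i weight i + s *: delta_mx 0 j /\ `|s| <= 1.
Proof.
move=> hx.
pose d (u : R) i := ((x 0 i)%:~R - u) ^+ 2.
have [i0 hi0 mi0] : exists2 i0 : 'I_43, (i0 < 28)%N &
    forall i : 'I_43, (i < 28)%N -> d (2 * t) i0 <= d (2 * t) i.
  case: (@arg_minP _ _ _ (ord0 : 'I_43) (fun i => (i < 28)%N) (d (2 * t))) => //.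
  by move=> i *; exists i.
have [j0 hj0 mj0] : exists2 j0 : 'I_43, (28 <= j0)%N &
    forall i : 'I_43, (28 <= i)%N -> d (3 * t) j0 <= d (3 * t) i.
  case: (@arg_minP _ _ _ (ord_max : 'I_43) (fun i => 28 <= i)%N (d (3 * t))) => //.
  by move=> i *; exists i.
have hmin : d (2 * t) i0 *+ 28 + d (3 * t) j0 *+ 15 < 1.
  apply: le_lt_trans hx; rewrite -weight_class_sum; apply: ler_sum => i _.
  rewrite /weight; case: ltnP => hi; rewrite [t * _]mulrC; first exact: mi0.
  exact: mj0.
have [k hk2 hk3] : exists2 k : int, x 0 i0 = 2 * k & x 0 j0 = 3 * k.
  have : ((3 * x 0 i0 - 2 * x 0 j0) ^+ 2)%:~R < 1 :> R.
    rewrite rmorphXn rmorphB !rmorphM /=; move: hmin; rewrite /d.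
    set a : R := (x 0 i0)%:~R; set b : R := (x 0 j0)%:~R => hmin.
    (* With X = a - 2t and Y = b - 3t, 420 (3X - 2Y)^2 + (56X + 45Y)^2 = 247 (28X^2 + 15Y^2), hence
       (3a - 2b)^2 < 247/420. *)
    have := sqr_ge0 (56 * (a - 2 * t) + 45 * (b - 3 * t)).
    by rewrite intr2 intr3; nra.
  rewrite ltrz1 => h; exists (x 0 j0 - x 0 i0); nia.
pose u := t - k%:~R.
(* 247 = 28 * 4 + 15 * 9; the bound 1/15 below comes from 15^2 < 247. *)
have hu : 247 * u ^+ 2 < 1.
  by move: hmin; rewrite /d hk2 hk3 !rmorphM /= intr2 intr3 /u; nra.
have u15 : `|u| < 1 / 15 by rewrite ltr_norml; apply/andP; split; nra.
pose y i := x 0 i - k * weight i.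
have hy : \sum_i ((y i)%:~R - u * (weight i)%:~R) ^+ 2 < 1.
  apply: le_lt_trans hx; apply: ler_sum => i _.
  by rewrite /y /u rmorphB rmorphM /= le_eqVlt; apply/orP; left; apply/eqP; ring.
have uw_small i : `|u * (weight i)%:~R| <= 1 / 5.
  rewrite normrM [leRHS](_ : _ = 1 / 15 * 3); last by field.
  apply: ler_pM => //; first exact: ltW.
  by rewrite /weight; case: ifP => _; rewrite ger0_norm //; lra.
have y_far i : y i != 0 ->
    (4 / 5) ^+ 2 <= ((y i)%:~R - u * (weight i)%:~R) ^+ 2.
  move=> yi; have w3 := uw_small i.
  apply: le_trans (int_dist_ge yi _); last by lra.
  by rewrite ler_sqr ?nnegrE; lra.
have y_le1 i : `|y i| <= 1.
  rewrite leNgt; apply/negP => yi.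
  have : ((y i)%:~R - u * (weight i)%:~R) ^+ 2 < 1.
    apply: le_lt_trans hy; rewrite (bigD1 i) //= lerDl sumr_ge0 // => *.
    exact: sqr_ge0.
  apply/negP; rewrite -leNgt.
  have w3 := uw_small i.
  have y2 : 2 <= `|(y i)%:~R| :> R by rewrite -intr_norm (ler_int _ 2); lia.
  rewrite -[leRHS]real_normK ?num_real // -[leLHS](expr1n _ 2) ler_sqr ?nnegrE //.
  by apply: le_trans (lerB_dist _ _); lra.
(* Two nonzero coordinates would contribute at least 2 * 16/25 > 1. *)
have y_uniq i j : y i != 0 -> y j != 0 -> i = j.
  move=> yi yj; apply/eqP; apply/negP => /negP ij; move: hy; apply/negP.
  rewrite -leNgt (bigD1 i) //= (bigD1 j) 1?eq_sym //= addrA.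
  have := y_far i yi; have := y_far j yj.
  set r := \sum_(_ | _) _; have : 0 <= r by apply: sumr_ge0 => *; exact: sqr_ge0.
  by lra.
have [[j yj]|y0] := pselect (exists j, y j != 0).
  exists k, (y j), j; split => //; apply/rowP => i; rewrite !mxE eqxx /=.
  have [->|ij] := eqVneq i j; first by rewrite /y; lia.
  suff : y i = 0 by rewrite /y; lia.
  by apply/eqP; apply: contraNT ij => yi; apply/eqP; exact: y_uniq.
exists k, 0, 0; split => //; apply/rowP => i; rewrite !mxE.
suff : y i = 0 by rewrite /y; lia.
by apply/eqP; apply: contra_notT y0 => yi; exists i.
Qed.

(** * Lattices generated by the rows of a real matrix *)

Definition row_lattice (R : realType) (n m : nat) (M : 'M[R]_(n, m)) :
    set 'rV[R]_m :=
  [set v | exists z : 'rV[int]_n, v = map_mx intr z *m M].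

Lemma row_lattice_zmod (R : realType) (n m : nat) (M : 'M[R]_(n, m)) :
  zmod_closed (mem (row_lattice M)).
Proof.
split=> [|u v]; rewrite !inE; first by exists 0; rewrite map_mx0 mul0mx.
by move=> [z ->] [y ->]; exists (z - y); rewrite map_mxB mulmxBl.
Qed.

Lemma row_lattice_row (R : realType) (n m : nat) (M : 'M[R]_(n, m)) (i : 'I_n) :
  row_lattice M (row i M).
Proof. by exists (delta_mx 0 i); rewrite map_delta_mx -rowE. Qed.

Lemma row_lattice_basis (R : realType) (n m : nat) (M : 'M[R]_(n, m)) :
  row_free M -> is_lattice_basis (row_lattice M) [tuple row i M | i < n].
Proof.
move=> /row_freeP[K MK]; split.
- by move=> v /mapP[i _ ->]; rewrite inE; exact: row_lattice_row.
- apply/freeP => k; under eq_bigr do rewrite -tnth_nth tnth_mktuple.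
  move=> k0 i; have : (\row_j k j) *m M = 0.
    by rewrite mulmx_sum_row -{}[RHS]k0; apply: eq_bigr => j _; rewrite mxE.
  move/(congr1 (fun v => (v *m K) 0 i)).
  by rewrite -mulmxA MK mulmx1 mul0mx !mxE.
- apply/seteqP; split => v /= [z ->].
    exists (\row_i z i); rewrite mulmx_sum_row; apply: eq_bigr => i _.
    by rewrite -tnth_nth tnth_mktuple !mxE scaler_int.
  exists [ffun i => z 0 i]; rewrite mulmx_sum_row; apply: eq_bigr => i _.
  by rewrite -tnth_nth tnth_mktuple !mxE ffunE scaler_int.
Qed.

Lemma lattice_basis_rank (R : realType) (n m : nat) (L : set 'rV[R]_m)
    (b : n.-tuple 'rV[R]_m) :
  is_lattice_basis L b -> lattice_rank L n.
Proof.
move=> [bL b_free bspan]; exists <<b>>%VS; split; last first.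
  by rewrite (eqnP b_free) size_tuple.
apply/seteqP; split => v /=; first by exists b.
move=> [s [sL]]; apply: subvP; apply/span_subvP => u /sL.
rewrite inE -bspan => -[z ->]; apply: rpred_sum => i _.
by rewrite rpredMz // memv_span // mem_nth // size_tuple.
Qed.

Lemma lattice_rank_uniq (R : realType) (m : nat) (L : set 'rV[R]_m) (n p : nat) :
  lattice_rank L n -> lattice_rank L p -> n = p.
Proof.
move=> [U [UL <-]] [V [VL <-]]; congr (\dim _); apply/vspaceP => v.
have UV : ([set` U] = [set` V])%classic by rewrite UL VL.
have {UV} [UV VU] : (v \in U <-> v \in V) by move/(congr1 (@^~ v)): UV => /= ->.
by apply/idP/idP.
Qed.

(** Integer combinations of [b] keep the [j]-th coordinate divisible by [d], yet row [j] of [M] is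
    in the lattice with [j]-th coordinate 1. For [d] not a unit this rules out a basis. *)
Lemma lattice_basis_dvd (R : realType) (n p m : nat) (M : 'M[R]_(n, m))
    (b : p.-tuple 'rV[R]_m) (d : int) (j : 'I_n) :
  row_free M -> is_lattice_basis (row_lattice M) b ->
  (forall i, exists2 z, tnth b i = map_mx intr z *m M & (d %| z 0%R j)%Z) ->
  (d %| 1)%Z.
Proof.
move=> /row_freeP[K MK] [_ _ bspan] /fin_all_exists2[z hz dz].
have [a ha] : [set v | inIntSpan b v]%classic (row j M).
  by rewrite bspan; exact: row_lattice_row.
have -> : 1%Z = \sum_i z i 0 j * a i.
  apply: (intr_inj (R := R)); move/(congr1 (fun v => (v *m K) 0 j)): ha.
  rewrite -row_mul MK mulmx_suml summxE !mxE eqxx => e; apply: etrans e _.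
  rewrite rmorph_sum; apply: eq_bigr => i _.
  by rewrite -tnth_nth hz -scaler_int -scalemxAl -mulmxA MK mulmx1 !mxE rmorphM
             mulrC.
by apply: rpred_sum => i _; exact/dvdz_mulr/dz.
Qed.

(** * The lattice of rank 43 and its norm *)

Definition weight_row : 'rV[int]_43 := \row_i weight i.

(* The orthogonal projection along w, with an extra coordinate t / 2 where
   t w is the component along w; 247 is the squared norm of w. *)
Definition frame (R : realType) : 'M[R]_(43, 43 + 1) :=
  let w := map_mx intr weight_row in
  row_mx (1%:M - 247^-1 *: (w^T *m w)) ((2 * 247)^-1 *: w^T).

Lemma frame_free (R : realType) : row_free (frame R).
Proof.
(* Twice the last coordinate is t, so adding that multiple of w undoes the projection. *)
apply/row_freeP; exists (col_mx 1%:M (2 *: map_mx intr weight_row)).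
rewrite mul_row_col mulmx1 -scalemxAl -scalemxAr scalerA.
have -> : (2 * 247)^-1 * 2 = 247^-1 :> R by field.
by rewrite subrK.
Qed.

(** The coefficient t of the projection of [z] on the line of w: the inner product with w over the
    squared norm of w. *)
Definition frame_height {R : realType} (z : 'rV[int]_43) : R :=
  (\sum_i (z 0 i)%:~R * (weight i)%:~R) / 247.

Lemma frame_entry (R : realType) (z : 'rV[int]_43) i :
  (map_mx intr z *m frame R) 0 (lshift 1 i) =
  (z 0 i)%:~R - frame_height z * (weight i)%:~R.
Proof.
rewrite mul_mx_row row_mxEl mulmxBr mulmx1 -scalemxAr mulmxA !mxE.
congr (_ - _); rewrite big_ord1 !mxE /frame_height mulrA; congr (_ * _).
by rewrite mulrC; congr (_ / _); apply: eq_bigr => j _; rewrite !mxE.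
Qed.

Lemma frame_last (R : realType) (z : 'rV[int]_43) :
  (map_mx intr z *m frame R) 0 (rshift 43 ord0) = frame_height z / 2.
Proof.
rewrite mul_mx_row row_mxEr -scalemxAr !mxE mulrC /frame_height.
rewrite -mulrA -invfM [247 * 2]mulrC.
by congr (_ * _); apply: eq_bigr => j _; rewrite !mxE.
Qed.

Lemma enorm_sqr (R : realType) m (v : 'rV[R]_m) :
  enorm v ^+ 2 = \sum_i v 0 i ^+ 2.
Proof. by rewrite sqr_sqrtr // sumr_ge0 // => *; exact: sqr_ge0. Qed.

Lemma enorm_ge0 (R : realType) m (v : 'rV[R]_m) : 0 <= enorm v.
Proof. exact: sqrtr_ge0. Qed.

Lemma frame_normE (R : realType) (z : 'rV[int]_43) :
  enorm (map_mx intr z *m frame R) ^+ 2 =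
  \sum_i ((z 0 i)%:~R - frame_height z * (weight i)%:~R) ^+ 2
  + (frame_height z / 2) ^+ 2.
Proof.
rewrite enorm_sqr big_split_ord big_ord1 frame_last /=.
by under eq_bigr do rewrite frame_entry.
Qed.

Lemma frame_height_near (R : realType) (k s : int) j :
  frame_height (k *: weight_row + s *: delta_mx 0 j) =
  k%:~R + s%:~R * (weight j)%:~R / 247 :> R.
Proof.
have n0 : 247 != 0 :> R by rewrite pnatr_eq0.
rewrite /frame_height; apply: (canLR (mulfK n0)); rewrite mulrDl mulfVK //.
under eq_bigr do rewrite !mxE eqxx /= rmorphD !rmorphM /= mulrDl -mulrA -expr2.
rewrite big_split -mulr_sumr sum_weight2; congr (_ + _).
rewrite (bigD1 j) //= eqxx mulr1 big1 ?addr0 // => i /negPf ->.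
by rewrite mulr0 mul0r.
Qed.

Lemma frame_norm_near (R : realType) (k s : int) j :
  enorm (map_mx intr (k *: weight_row + s *: delta_mx 0 j) *m frame R) ^+ 2 =
  s%:~R ^+ 2 * (1 - (weight j)%:~R ^+ 2 / 247) +
  (k%:~R + s%:~R * (weight j)%:~R / 247) ^+ 2 / 4.
Proof.
rewrite frame_normE frame_height_near exprMn.
rewrite [2^-1 ^+ 2](_ : _ = 4^-1); last by field.
congr (_ + _); set c := _ * _ / 247.
(* The multiples of w cancel up to -[c] w, leaving [s] e_j - [c] w; [D j] collects the extra terms
   of the square at [j]. *)
pose D i : R := s%:~R ^+ 2 - 2 * s%:~R * c * (weight i)%:~R.
rewrite (eq_bigr (fun i => c ^+ 2 * (weight i)%:~R ^+ 2 +
                           (if i == j then D j else 0))); last first.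
  move=> i _; rewrite !mxE eqxx /= rmorphD !rmorphM /= /D.
  by case: eqVneq => [->|_] /=; ring.
rewrite big_split -mulr_sumr sum_weight2 -big_mkcond big_pred1_eq /D /c /=.
by field.
Qed.

(** * Discreteness, short vectors and the primitive minimum *)

Lemma isolated_zmod (R : realType) (m : nat) (L : set 'rV[R]_m) (e : R) :
  0 < e -> zmod_closed (mem L) ->
  (forall v, L v -> (forall i, `|v 0 i| < e) -> v = 0) ->
  (L `<=` isolated L)%classic.
Proof.
move=> e0 [_ LB] L0 v Lv; split; first by rewrite inE.
(* For [u] in this sup-norm ball, [v - u] is a lattice vector with all coordinates below [e], hence
   0. *)
exists (ball v e); first exact: nbhsx_ballx.
apply/seteqP; split => [u /= [[_ vu] Lu]|_ ->]; last first.
  by split => //; exact: ballxx.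
apply/eqP; rewrite eq_sym -subr_eq0; apply/eqP/L0 => [|i].
  by have := LB v u; rewrite !inE; apply.
by rewrite !mxE; exact: (vu 0 i).
Qed.

Definition frame_lattice (R : realType) : set 'rV[R]_(43 + 1) :=
  row_lattice (frame R).

Arguments frame_lattice R : clear implicits.

(** The value of the primitive minimum: index 0 has weight 2, and the rows of weight 2 are the
    longest. *)
Definition min_length (R : realType) : R :=
  enorm (row (0 : 'I_43) (frame R)).

Lemma rowE_near (R : realType) j :
  row j (frame R) =
  map_mx intr (0 *: weight_row + 1 *: delta_mx 0 j) *m frame R.
Proof. by rewrite scale0r add0r scale1r map_delta_mx -rowE. Qed.

Lemma row_frame_norm (R : realType) j :
  enorm (row j (frame R)) ^+ 2 =
  1 - (weight j)%:~R ^+ 2 / 247 + ((weight j)%:~R / 247) ^+ 2 / 4.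
Proof. by rewrite rowE_near frame_norm_near; ring. Qed.

Lemma row_frame_le (R : realType) j : enorm (row j (frame R)) <= min_length R.
Proof.
rewrite -ler_sqr ?nnegrE ?enorm_ge0 // !row_frame_norm.
rewrite [weight 0]/weight /= intr2.
by case: (weight_cases j) => ->; rewrite ?intr2 ?intr3; lra.
Qed.

(** Since [min_length R ^+ 2 < 1], dropping the height term leaves a squared distance to the line
    below 1. *)
Lemma frame_short (R : realType) (z : 'rV[int]_43) :
  enorm (map_mx intr z *m frame R) <= min_length R ->
  exists k s j, z = k *: weight_row + s *: delta_mx 0 j /\ `|s| <= 1.
Proof.
move=> hz; apply: (@near_weight_line R _ (frame_height z)).
apply: (@le_lt_trans _ _ (enorm (map_mx intr z *m frame R) ^+ 2)).
  by rewrite frame_normE lerDl sqr_ge0.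
apply: (@le_lt_trans _ _ (min_length R ^+ 2)).
  by rewrite ler_sqr ?nnegrE ?enorm_ge0.
by rewrite row_frame_norm [weight 0]/weight /= intr2; lra.
Qed.

(** An odd coordinate 0 forces [z] = k w +- e_0, of height (247k +- 2)/247. As |247k +- 2| >= 2,
    such a vector is no shorter than row 0. *)
Lemma frame_even (R : realType) (z : 'rV[int]_43) :
  enorm (map_mx intr z *m frame R) < min_length R -> (2 %| z 0%R 0%R)%Z.
Proof.
move=> hz; have [k [s [j [zE s1]]]] := frame_short (ltW hz).
have [/andP[s0 /eqP j0]|] := boolP ((s != 0) && (j == 0)); last first.
  move=> h; rewrite zE !mxE eqxx /= [weight _]/weight /=.
  move: h; rewrite negb_and negbK [0 == j]eq_sym.
  by case: (j == 0) => /=; rewrite ?orbF ?orbT; lia.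
move: hz; rewrite ltNge -ler_sqr ?nnegrE ?enorm_ge0 //.
rewrite row_frame_norm zE frame_norm_near j0 [weight _]/weight /= intr2.
have s2 : s%:~R ^+ 2 = 1 :> R by exact: intr_unit_sqr.
have : 4 <= ((247 * k + s * 2) ^+ 2)%:~R :> R by rewrite (ler_int _ 4); nia.
by rewrite s2 rmorphXn rmorphD !rmorphM /= intr2 (_ : 247%:~R = 247 :> R) //; lra.
Qed.

(** A term +- e_j alone costs at least 1 - 9/247 > 1/4 in squared length. *)
Lemma frame_shortest (R : realType) (z : 'rV[int]_43) :
  enorm (map_mx intr z *m frame R) ^+ 2 <= 4^-1 ->
  exists k, z = k *: weight_row.
Proof.
move=> hz.
have [|k [s [j [zE s1]]]] := @frame_short R z.
  rewrite -ler_sqr ?nnegrE ?enorm_ge0 //; apply: le_trans hz _.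
  by rewrite row_frame_norm [weight _]/weight /= intr2; lra.
exists k; suff s0 : s = 0 by rewrite zE s0 scale0r addr0.
apply: contraTeq hz => s0; rewrite zE frame_norm_near -ltNge.
have -> : s%:~R ^+ 2 = 1 :> R by exact: intr_unit_sqr.
set h := (_ + _) ^+ 2; have : 0 <= h by exact: sqr_ge0.
by case: (weight_cases j) => ->; rewrite ?intr2 ?intr3; lra.
Qed.

Lemma weight_row_norm (R : realType) (k : int) :
  enorm (map_mx intr (k *: weight_row) *m frame R) ^+ 2 = k%:~R ^+ 2 / 4.
Proof.
have -> : k *: weight_row = k *: weight_row + 0 *: delta_mx 0 0.
  by rewrite scale0r addr0.
by rewrite frame_norm_near; ring.
Qed.

Lemma frame_lattice_isolated (R : realType) :
  (frame_lattice R `<=` isolated (frame_lattice R))%classic.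
Proof.
(* 44 coordinates below 1/14 give a squared length below 44/196 < 1/4. *)
apply: (@isolated_zmod _ _ _ (1 / 14)); rewrite ?divr_gt0 //.
  exact: row_lattice_zmod.
move=> _ [z ->] small.
have z_small : enorm (map_mx intr z *m frame R) ^+ 2 < 1 / 4.
  rewrite enorm_sqr; apply: (@le_lt_trans _ _ (\sum_(i < 43 + 1) (1 / 14) ^+ 2)).
    apply: ler_sum => i _; rewrite -[leLHS]real_normK ?num_real //.
    by rewrite ler_sqr ?nnegrE ?divr_ge0 // ltW.
  by rewrite sumr_const card_ord; lra.
have [|k zE] := @frame_shortest R z; first by rewrite -div1r ltW.
suff k0 : k = 0 by rewrite zE k0 scale0r map_mx0 mul0mx.
move: z_small; rewrite zE weight_row_norm => k1.
have : (k ^+ 2)%:~R < 1 :> R by rewrite rmorphXn /=; lra.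
by rewrite ltrz1; nia.
Qed.

(** Comparison with w, a nonzero vector of length 1/2, gives the bound of [frame_shortest]. *)
Lemma shortest_in_weight_line (R : realType) (z : 'rV[int]_43) :
  is_shortest (frame_lattice R) (map_mx intr z *m frame R) ->
  exists k, z = k *: weight_row.
Proof.
case=> _ _ min; apply: (@frame_shortest R).
have w4 := weight_row_norm R 1; rewrite scale1r expr1n div1r in w4.
rewrite -w4 ler_sqr ?nnegrE ?enorm_ge0 //; apply: min; first by exists weight_row.
apply/eqP => w0; move: w4; rewrite w0 enorm_sqr big1 => [|i _].
  by move/eqP; rewrite eq_sym invr_eq0 pnatr_eq0.
by rewrite mxE expr0n.
Qed.

Lemma frame_primitive_minimum (R : realType) :
  is_primitive_minimum (frame_lattice R) 43 (min_length R).
Proof.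
have basis := row_lattice_basis (frame_free R); split => [|r].
  exists [tuple row i (frame R) | i < 43]; split.
    by exists 43, [tuple row i (frame R) | i < 43]; split => //; exact: prefix_refl.
  by move=> _ /mapP[i _ ->]; exact: row_frame_le.
move=> [s [[n [b [b_basis sb]]] sr]].
(* The basis completing [s] has exactly 43 members, so it is [s] itself. *)
have n43 := lattice_rank_uniq (lattice_basis_rank b_basis) (lattice_basis_rank basis).
subst n; have bs : b = s.
  by move: sb; rewrite prefixE take_oversize ?size_tuple // => /eqP/val_inj.
rewrite leNgt; apply/negP => r_lt.
suff : (2 %| 1)%Z by [].
(* Were all members shorter than [min_length R], their coordinates 0 would all be even. *)
apply: (lattice_basis_dvd (frame_free R) b_basis (j := 0)) => i.
have [bL _ _] := b_basis; have := bL _ (mem_tnth i b).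
rewrite inE => -[z hz]; exists z => //.
by apply/(@frame_even R)/le_lt_trans/r_lt; rewrite -hz sr // -bs mem_tnth.
Qed.

(** * Bases containing a shortest vector *)

Theorem theorem1p5 (R : realType) :
  exists (m : nat) (L : set 'rV[R]_m),
    is_lattice L /\ lattice_rank L 43 /\
    exists l : R, is_primitive_minimum L 43 l /\
      forall b : 43.-tuple 'rV[R]_m,
        is_lattice_basis L b ->
        (exists2 v, v \in b & is_shortest L v) ->
        \big[Num.max/0]_(v <- b) enorm v > l.
Proof.
exists (43 + 1)%N, (frame_lattice R); split; [|split].
- by split; [exact: row_lattice_zmod|exact: frame_lattice_isolated].
- exact: lattice_basis_rank (row_lattice_basis (frame_free R)).
exists (min_length R); split; first exact: frame_primitive_minimum.
move=> b b_basis [v vb v_short]; rewrite ltNge; apply/negP => b_le.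
have [bL _ _] := b_basis.
have {bL} /fin_all_exists[z hz] (i : 'I_43) :
    exists y : 'rV[int]_43, tnth b i = map_mx intr y *m frame R.
  by have := bL (tnth b i); rewrite mem_tnth inE => /(_ isT).
(* [f i] is the one coordinate at which [z i] may differ from a multiple of w. *)
have /fin_all_exists[f hf] (i : 'I_43) :
    exists j, forall l, l != j -> (weight l %| z i 0%R l)%Z.
  have [|k [s [j [-> _]]]] := @frame_short R (z i).
    rewrite -hz; apply: le_trans b_le; apply: le_bigmax_seq => //.
    exact: mem_tnth.
  by exists j => l /negPf lj; rewrite !mxE eqxx lj /= mulr0 addr0 dvdz_mull.
have /tnthP[i0 v_i0] := vb.
have [k zk] : exists k, z i0 = k *: weight_row.
  by apply: (@shortest_in_weight_line R); rewrite -hz -v_i0.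
(* The 42 basis vectors other than the shortest one account for at most 42 coordinates, so some [j]
   is missed. *)
have [j] : exists j, j \in ~: (f @: [set~ i0]).
  apply/card_gt0P; rewrite cardsCs finset.setCK card_ord subn_gt0.
  by rewrite (leq_ltn_trans (leq_imset_card _ _)) // cardsC1 card_ord.
rewrite inE => fj.
(* Every vector of b has j-th coordinate divisible by w_j, but e_j does not. *)
have [] : ~ (weight j %| 1)%Z by case: (weight_cases j) => ->.
apply: (lattice_basis_dvd (frame_free R) b_basis (j := j)) => i.
exists (z i) => //; have [->|ii0] := eqVneq i i0.
  by rewrite zk !mxE dvdz_mull.
by apply: hf; apply: contraNneq fj => ->; rewrite imset_f // !inE.
Qed.
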